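(* Let $S$ be a standard graded Koszul algebra over a field $k$, let $I\subset S$ be a proper homogeneous ideal containing no linear forms, and let $R=S/I$. Suppose that $\mathrm{reg}_{n+1}^R(k)\leq 1$ for some $n\geq 1$ and that $R$ satisfies the Green--Lazarsfeld condition $N_q$ over $S$ for some $q\geq 1$. Then $t_i^S(R)\leq 2i-q+1$ for $q+1\leq i\leq n$.
   Context: For a Noetherian standard graded algebra $A$ over a field $k$, a finitely generated graded $A$-module $N$ and an integer $i\ge 0$, set $t_i^A(N):=\sup\{j\in\mathbb{Z}\mid \mathrm{Tor}_i^A(k,N)_j\neq 0\}$ (with $\sup\emptyset=-\infty$). For an integer $n$, $\mathrm{reg}_n^A(N):=\max\{t_i^A(N)-i\mid i\le n\}$, and $\mathrm{reg}^A(N):=\sup_n \mathrm{reg}_n^A(N)$. The algebra $A$ is a Koszul algebra over $k$ if $\mathrm{reg}^A(k)=0$. $R=S/I$ satisfies the Green--Lazarsfeld condition $N_q$ over $S$ if $t_i^S(R)=i+1$ for all $1\leq i\leq q$. *)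

(* Defs.v *)
From HB Require Import structures.
From mathcomp Require Import all_boot all_order all_algebra.
From mathcomp Require Import boolp classical_sets constructive_ereal.

Set Implicit Arguments.
Unset Strict Implicit.
Unset Printing Implicit Defensive.

Import Order.TTheory GRing.Theory Num.Theory.

Local Open Scope classical_set_scope.
Local Open Scope ring_scope.
Local Open Scope quotient_scope.

(* Internal direct sum decomposition V = \bigoplus_j H j; the carriers are    *)
(* infinite-dimensional in general, so {vspace _} is not available.           *)
Record is_grading (J : choiceType) (V : zmodType) (H : J -> set V) : Prop :=
  IsGrading {
  grading0 : forall j, H j 0;
  gradingB : forall j x y, H j x -> H j y -> H j (x - y);
  grading_span : forall x, exists (s : seq J) (f : J -> V),
    [/\ uniq s, forall j, H j (f j) & x = \sum_(j <- s) f j];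
  grading_indep : forall (s : seq J) (f : J -> V),
    uniq s -> (forall j, H j (f j)) -> \sum_(j <- s) f j = 0 ->
    forall j, j \in s -> f j = 0 }.

(* Every homogeneous component of an element of I lies in I. *)
Definition homogeneous (J : choiceType) (V : zmodType) (H : J -> set V)
    (I : {pred V}) : Prop :=
  forall (s : seq J) (f : J -> V), uniq s -> (forall j, H j (f j)) ->
    \sum_(j <- s) f j \in I -> forall j, j \in s -> f j \in I.

(* A nat-indexed grading seen as an int-indexed one: 0 in negative degrees. *)
Definition intpart (V : zmodType) (H : nat -> set V) (j : int) : set V :=
  match j with Posz n => H n | Negz _ => [set 0] end.

Definition noetherian (A : comNzRingType) : Prop :=
  forall J : {pred A^o}, submod_closed J ->
    exists2 s : seq A, {subset s <= J} &
      forall x, x \in J ->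
        exists c : nat -> A, x = \sum_(i < size s) c i * s`_i.

(* Standard gradings: A = \bigoplus_n A_n with A_0 = k and A = k[A_1].  The   *)
(* field k embeds in A, since algebras are nonzero here.  Finiteness of A_1   *)
(* is not included: it follows from [noetherian A].                           *)
Record std_grading (k : fieldType) (A : comAlgType k) := StdGrading {
  hpart :> nat -> set A;
  hpart_grading : is_grading hpart;
  hpartM : forall i j x y, hpart i x -> hpart j y -> hpart (i + j)%N (x * y);
  hpart_0 : hpart 0%N = range (fun c : k => c%:A);
  hpart_gen : forall B : {pred A}, subalg_closed B ->
    (forall x, hpart 1%N x -> x \in B) -> forall x, x \in B }.

Record graded_module (k : fieldType) (A : comAlgType k) (G : std_grading A) :=
  GradedModule {
  gm_sort :> lmodType A;
  gm_part : int -> set gm_sort;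
  gm_grading : is_grading gm_part;
  gm_scale : forall (i : nat) (j : int) a x,
    G i a -> gm_part j x -> gm_part (i%:Z + j) (a *: x) }.


Section GradingLemmas.
Variables (J : choiceType) (V : zmodType) (H : J -> set V).
Hypothesis gH : is_grading H.

Lemma gradingN j x : H j x -> H j (- x).
Proof. by move=> Hx; rewrite -[- x]add0r; apply: gradingB => //; apply: grading0. Qed.

Lemma gradingD j x y : H j x -> H j y -> H j (x + y).
Proof.
by move=> Hx Hy; rewrite -[y]opprK; apply: gradingB => //; apply: gradingN.
Qed.

Lemma sum_extend (s u : seq J) (f : J -> V) : uniq s -> uniq u ->
  {subset s <= u} ->
  \sum_(j <- s) f j = \sum_(j <- u) (if j \in s then f j else 0).
Proof.
move=> us uu su; rewrite -big_mkcond -big_filter; apply: perm_big.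
apply: uniq_perm; rewrite ?filter_uniq // => j; rewrite mem_filter.
by case: (boolP (j \in s)) => //= /su ->.
Qed.

Lemma sum_mergeB (s t : seq J) (f g : J -> V) : uniq s -> uniq t ->
  \sum_(j <- s) f j - \sum_(j <- t) g j =
  \sum_(j <- undup (s ++ t))
    ((if j \in s then f j else 0) - (if j \in t then g j else 0)).
Proof.
move=> us ut; rewrite sumrB; congr (_ - _); apply: sum_extend;
  rewrite ?undup_uniq // => j; rewrite mem_undup mem_cat => ->//.
by rewrite orbT.
Qed.

Lemma grading_if (s : seq J) (f : J -> V) : (forall j, H j (f j)) ->
  forall j, H j (if j \in s then f j else 0).
Proof. by move=> Hf j; case: ifP => _ //; apply: grading0. Qed.

Lemma grading_disj (s t : seq J) (f g : J -> V) : uniq s -> uniq t ->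
  (forall j, H j (f j)) -> (forall j, H j (g j)) ->
  \sum_(j <- s) f j = \sum_(j <- t) g j ->
  forall j, j \in s -> j \notin t -> f j = 0.
Proof.
move=> us ut Hf Hg /eqP; rewrite -subr_eq0 sum_mergeB // => /eqP e j js jt.
have := grading_indep gH (undup_uniq _) _ e.
move=> /(_ _ j); rewrite mem_undup mem_cat js (negPf jt) subr0; apply => // i.
by apply: gradingB => //; apply: grading_if.
Qed.

End GradingLemmas.

Lemma image_grading (J : choiceType) (V W : zmodType) (H : J -> set V)
    (p : {additive V -> W}) (I : {pred V}) :
  (forall y, exists x, p x = y) -> (forall x, p x = 0 <-> x \in I) ->
  is_grading H -> homogeneous H I -> is_grading (fun j => p @` H j).
Proof.
move=> psurj pker gH hI; split.
- by move=> j; exists 0; rewrite ?raddf0 //; apply: grading0.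
- move=> j _ _ [x Hx <-] [y Hy <-]; exists (x - y); rewrite ?raddfB //.
  exact: gradingB.
- move=> y; have [x <-] := psurj y; have [s [f [us Hf ->]]] := grading_span gH x.
  exists s, (p \o f); split=> //; last by rewrite raddf_sum.
  by move=> j; exists (f j).
- move=> s f us Hf e j js.
  have [g Hg gf] := all_sig2 (fun i => cid2 (Hf i)).
  rewrite -gf; apply/pker; apply: hI us Hg _ _ js; apply/pker.
  by rewrite raddf_sum -[RHS]e; apply: eq_bigr.
Qed.

Lemma intpart_grading (V : zmodType) (H : nat -> set V) :
  is_grading H -> is_grading (intpart H).
Proof.
move=> gH; split.
- by case=> n //=; apply: grading0.
- by case=> n x y /=; [apply: gradingB|move=> -> ->; rewrite subrr].
- move=> x; have [s [f [us Hf ->]]] := grading_span gH x.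
  exists (map Posz s), (fun j => if j is Posz n then f n else 0); split.
  + by rewrite map_inj_uniq // => ? ? [].
  + by case.
  + by rewrite big_map.
- move=> s f us Hf e.
  have fN n : f (Negz n) = 0 by have := Hf (Negz n).
  pose t := [seq `|j|%N | j <- s & 0 <= j].
  have ut : uniq t.
    rewrite map_inj_in_uniq ?filter_uniq // => -[] m [] n;
    by rewrite !mem_filter //= => _ _ ->.
  have et : \sum_(n <- t) f (Posz n) = 0.
    rewrite big_map big_filter -[RHS]e big_mkcond /=; apply: eq_bigr.
    by case=> n _ //=; rewrite fN.
  case=> n ns //; apply: (grading_indep gH ut (f := f \o Posz)) => //.
    by move=> m; apply: (Hf (Posz m)).
  by apply/mapP; exists (Posz n); rewrite ?mem_filter.
Qed.

(* The quotient A/I carries two module structures, over k (as an algebra) and *)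
(* over A; they are put on two copies of the library's {ideal_quot I}.        *)

Definition quot_alg (k : fieldType) (A : comAlgType k) (I : idealr A) : Type :=
  {ideal_quot I}.
Definition quot_mod (A : comNzRingType) (I : idealr A) : Type :=
  {ideal_quot I}.

Section QuotAlg.
Variables (k : fieldType) (A : comAlgType k) (I : idealr A).
Local Notation Q := (quot_alg I).

HB.instance Definition _ := GRing.ComNzRing.copy Q {ideal_quot I}.

Definition quot_pi (x : A) : Q := \pi_{ideal_quot I} x.

Fact quot_pi_is_zmod_morphism : zmod_morphism quot_pi.
Proof. by move=> x y; rewrite /quot_pi rmorphB. Qed.
Fact quot_pi_is_monoid_morphism : monoid_morphism quot_pi.
Proof. by split=> [|x y]; rewrite /quot_pi ?rmorph1 ?rmorphM. Qed.
HB.instance Definition _ :=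
  GRing.isZmodMorphism.Build A Q quot_pi quot_pi_is_zmod_morphism.
HB.instance Definition _ :=
  GRing.isMonoidMorphism.Build A Q quot_pi quot_pi_is_monoid_morphism.

Definition quot_scale (c : k) (y : Q) : Q := quot_pi c%:A * y.

Fact quot_scaleA a b y : quot_scale a (quot_scale b y) = quot_scale (a * b) y.
Proof. by rewrite /quot_scale mulrA -rmorphM -scalerAl mul1r scalerA. Qed.
Fact quot_scale1 : left_id 1 quot_scale.
Proof. by move=> y; rewrite /quot_scale scale1r rmorph1 mul1r. Qed.
Fact quot_scaleDr : right_distributive quot_scale +%R.
Proof. by move=> a x y; rewrite /quot_scale mulrDr. Qed.
Fact quot_scaleDl y : {morph quot_scale^~ y : a b / a + b}.
Proof. by move=> a b; rewrite /quot_scale scalerDl rmorphD mulrDl. Qed.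
HB.instance Definition _ := GRing.Zmodule_isLmodule.Build k Q
  quot_scaleA quot_scale1 quot_scaleDr quot_scaleDl.
Fact quot_scaleAl (a : k) (x y : Q) : a *: (x * y) = a *: x * y.
Proof. exact: mulrA. Qed.
HB.instance Definition _ := GRing.Lmodule_isLalgebra.Build k Q quot_scaleAl.
HB.instance Definition _ := GRing.Lalgebra_isComAlgebra.Build k Q.

Lemma quot_pi_surj (y : Q) : exists x, quot_pi x = y.
Proof. by exists (repr (y : {ideal_quot I})); rewrite /quot_pi reprK. Qed.

Lemma quot_pi_eq0 x : quot_pi x = 0 <-> x \in I.
Proof.
have -> : (x \in I) = (x - 0 \in I) by rewrite subr0.
rewrite Quotient.idealrBE.
have e0 : \pi_{ideal_quot I} (0 : A) = 0 by rewrite rmorph0.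
by split=> [h|/eqP h]; [apply/eqP; rewrite e0|rewrite /quot_pi h e0].
Qed.

Lemma quot_piZ c x : quot_pi (c *: x) = c *: quot_pi x.
Proof. by rewrite -[c *: quot_pi x]/(_ * _) -rmorphM -scalerAl mul1r. Qed.

End QuotAlg.

Section QuotMod.
Variables (A : comNzRingType) (I : idealr A).
Local Notation M := (quot_mod I).

HB.instance Definition _ := GRing.Zmodule.copy M {ideal_quot I}.

Definition quotm_scale (a : A) (y : M) : M :=
  \pi_{ideal_quot I} a * (y : {ideal_quot I}).

Fact quotm_scaleA a b y :
  quotm_scale a (quotm_scale b y) = quotm_scale (a * b) y.
Proof. by rewrite /quotm_scale mulrA -rmorphM. Qed.
Fact quotm_scale1 : left_id 1 quotm_scale.
Proof. by move=> y; rewrite /quotm_scale rmorph1 mul1r. Qed.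
Fact quotm_scaleDr : right_distributive quotm_scale +%R.
Proof. by move=> a x y; rewrite /quotm_scale mulrDr. Qed.
Fact quotm_scaleDl y : {morph quotm_scale^~ y : a b / a + b}.
Proof. by move=> a b; rewrite /quotm_scale rmorphD mulrDl. Qed.
HB.instance Definition _ := GRing.Zmodule_isLmodule.Build A M
  quotm_scaleA quotm_scale1 quotm_scaleDr quotm_scaleDl.

End QuotMod.

Section QuotGrading.
Variables (k : fieldType) (A : comAlgType k) (G : std_grading A).
Variables (I : idealr A) (hI : homogeneous G I).

Definition quot_part (n : nat) : set (quot_alg I) := @quot_pi k A I @` G n.

Fact quot_part_grading : is_grading quot_part.
Proof.
apply: (@image_grading _ _ _ G (@quot_pi k A I) I) hI.
- exact: quot_pi_surj.
- exact: quot_pi_eq0.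
- exact: hpart_grading.
Qed.

Fact quot_partM i j x y :
  quot_part i x -> quot_part j y -> quot_part (i + j)%N (x * y).
Proof.
move=> [a Ga <-] [b Gb <-]; exists (a * b); rewrite ?rmorphM //.
exact: hpartM.
Qed.

Fact quot_part_0 : quot_part 0%N = range (fun c : k => c%:A).
Proof.
apply/seteqP; split=> [_ [x + <-]|_ [c _ <-]].
  by rewrite hpart_0 => -[c _ <-]; exists c; rewrite // quot_piZ rmorph1.
by exists c%:A; [rewrite hpart_0; exists c|rewrite quot_piZ rmorph1].
Qed.

Fact quot_part_gen (B : {pred quot_alg I}) : subalg_closed B ->
  (forall x, quot_part 1%N x -> x \in B) -> forall x, x \in B.
Proof.
move=> [B1 Blin BM] hB y; have [x <-] := quot_pi_surj y.
pose C : {pred A} := [pred x | quot_pi I x \in B].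
apply: (hpart_gen (s := G) (B := C)).
  split; first by rewrite inE rmorph1.
    by move=> a u v; rewrite !inE => hu hv; rewrite rmorphD /= quot_piZ Blin.
  by move=> u v; rewrite !inE => hu hv; rewrite rmorphM BM.
by move=> z Gz; rewrite inE; apply: hB; exists z.
Qed.

(* The algebra A/I with (A/I)_n the image of A_n. *)
Definition quot_grading : std_grading (quot_alg I) :=
  StdGrading quot_part_grading quot_partM quot_part_0 quot_part_gen.

Definition quotm_part : int -> set (quot_mod I) := intpart quot_part.

Fact quotm_grading : is_grading quotm_part.
Proof. exact/intpart_grading/quot_part_grading. Qed.

Fact quotm_part_scale (i : nat) (j : int) (a : A) (x : quot_mod I) :
  G i a -> quotm_part j x -> quotm_part (i%:Z + j) (a *: x).
Proof.
move=> Ga; case: j => j; last first.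
  by move=> /= ->; rewrite scaler0; apply: (grading0 quotm_grading).
by move=> Gx; apply: quot_partM Gx; exists a.
Qed.

(* The graded A-module A/I. *)
Definition quot_module : graded_module G :=
  GradedModule quotm_grading quotm_part_scale.

End QuotGrading.


Section Irrelevant.
Variables (k : fieldType) (A : comAlgType k) (G : std_grading A).

(* A_+ = \bigoplus_(n > 0) A_n *)
Definition irrelevant : {pred A} := fun x =>
  `[< exists (s : seq nat) (f : nat -> A),
      [/\ uniq s, 0%N \notin s, forall j, G j (f j) &
          x = \sum_(j <- s) f j] >].

Let gG := hpart_grading G.

Lemma irrelevantB x y :
  x \in irrelevant -> y \in irrelevant -> x - y \in irrelevant.
Proof.
move=> /asboolP[s [f [us s0 Gf ->]]] /asboolP[t [g [ut t0 Gg ->]]].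
rewrite sum_mergeB //; apply/asboolP; do 2 eexists; split; last by [].
- exact: undup_uniq.
- by rewrite mem_undup mem_cat negb_or s0.
- by move=> j; apply: (gradingB gG); apply: (grading_if gG).
Qed.

Lemma irrelevant_part j x : G j.+1 x -> x \in irrelevant.
Proof.
move=> Gx; apply/asboolP; exists [:: j.+1], (fun i => if i == j.+1 then x else 0).
split=> //; last by rewrite big_seq1 eqxx.
by move=> i; case: eqP => [->//|_]; apply: (grading0 gG).
Qed.

Lemma irrelevant0 : 0 \in irrelevant.
Proof. by apply: (@irrelevant_part 0%N); apply: (grading0 gG). Qed.

Lemma irrelevant_sum (T : eqType) (s : seq T) (F : T -> A) :
  (forall i, i \in s -> F i \in irrelevant) ->
  \sum_(i <- s) F i \in irrelevant.
Proof.
move=> h; rewrite big_seq; apply: (big_ind (fun x => x \in irrelevant)) => [|x y hx hy|//].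
  exact: irrelevant0.
rewrite -[y]opprK; apply: irrelevantB => //; rewrite -[- y]add0r.
by apply: irrelevantB => //; apply: irrelevant0.
Qed.

Lemma irrelevant_homogeneous : homogeneous G irrelevant.
Proof.
move=> s f us Gf /asboolP[t [g [ut t0 Gg e]]] [|j] js.
  by rewrite (grading_disj gG us ut Gf Gg e js t0) irrelevant0.
exact: irrelevant_part (Gf _).
Qed.

Fact irrelevant_idealr : idealr_closed irrelevant.
Proof.
split; first exact: irrelevant0.
  apply/asboolP => -[t [g [ut t0 Gg e]]].
  have G1 : G 0%N 1 by rewrite hpart_0; exists 1; rewrite ?scale1r.
  pose f (j : nat) : A := if j == 0%N then 1 else 0.
  have Gf j : G j (f j) by case: j => // j; apply: (grading0 gG).
  have ef : \sum_(j <- [:: 0%N]) f j = \sum_(j <- t) g j by rewrite big_seq1.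
  have := grading_disj gG (s := [:: 0%N]) isT ut Gf Gg ef (mem_head _ _) t0.
  by move/eqP; rewrite oner_eq0.
move=> a u v hu hv; rewrite -[v]opprK; apply: irrelevantB; last first.
  by rewrite -[- v]add0r; apply: irrelevantB => //; apply: irrelevant0.
have [s [f [us Gf ->]]] := grading_span gG a.
move: hu => /asboolP[t [g [ut t0 Gg ->]]]; rewrite mulr_suml.
apply: irrelevant_sum => i _; rewrite mulr_sumr; apply: irrelevant_sum.
case=> [h|j _]; first by rewrite h in t0.
by apply: (@irrelevant_part (i + j)%N); rewrite -addnS; apply: hpartM.
Qed.
HB.instance Definition _ := isIdealr.Build A irrelevant irrelevant_idealr.

(* k = A/A_+ as a graded A-module. *)
Definition residue_field : graded_module G :=
  quot_module irrelevant_homogeneous.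

End Irrelevant.


(* A resolution ... -> F_1 -> F_0 -> M -> 0 by graded free modules of finite  *)
(* rank: F_i = \bigoplus_c A(-res_deg i c) is a space of row vectors, so the  *)
(* differential F_(i+1) -> F_i is v |-> v *m res_diff i.                      *)
Record free_resolution (k : fieldType) (A : comAlgType k) (G : std_grading A)
    (M : graded_module G) := FreeResolution {
  res_rank : nat -> nat;
  res_deg : forall i, 'I_(res_rank i) -> int;
  res_diff : forall i, 'M[A]_(res_rank i.+1, res_rank i);
  res_aug : 'I_(res_rank 0) -> M;
  res_diff_hom : forall i r c,
    intpart G (res_deg r - res_deg c) (res_diff i r c);
  res_aug_hom : forall c, gm_part (res_deg c) (res_aug c);
  res_aug_surj : forall m : M, exists v : 'rV[A]_(res_rank 0),
    m = \sum_c v 0 c *: res_aug c;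
  res_exact0 : forall v : 'rV[A]_(res_rank 0),
    \sum_c v 0 c *: res_aug c = 0 <->
    exists w : 'rV[A]_(res_rank 1), v = w *m res_diff 0;
  res_exactS : forall i (v : 'rV[A]_(res_rank i.+1)),
    v *m res_diff i = 0 <->
    exists w : 'rV[A]_(res_rank i.+2), v = w *m res_diff i.+1 }.

Section Tor.
Variables (k : fieldType) (A : comAlgType k) (G : std_grading A).
Variables (M N : graded_module G).

Section Tensor.
Variable F : free_resolution M.

(* F_i \otimes_A N = N^(rank F_i), with basis element c in degree res_deg c. *)
Definition tens (i : nat) : Type := 'I_(res_rank F i) -> N.

Definition tens_part (i : nat) (j : int) : set (tens i) :=
  [set z | forall c, gm_part (j - res_deg c) (z c)].

Definition tens_diff (i : nat) (z : tens i.+1) : tens i :=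
  fun c => \sum_r res_diff F i r c *: z r.

Definition tens_cycle (i : nat) : tens i -> Prop :=
  match i with
  | 0%N => fun=> True
  | i'.+1 => fun z => forall c, tens_diff z c = 0
  end.

(* H_i(F \otimes_A N)_j <> 0 *)
Definition homology_neq0 (i : nat) (j : int) : Prop :=
  exists z : tens i, [/\ tens_part j z, tens_cycle z &
    ~ exists2 w : tens i.+1, tens_part j w & forall c, tens_diff w c = z c].

End Tensor.

(* Tor_i^A(M, N)_j <> 0.  The homology does not depend on F (comparison theorem), *)
(* and F exists when A is Noetherian and M is finitely generated.             *)
Definition Tor_neq0 (i : nat) (j : int) : Prop :=
  exists F : free_resolution M, homology_neq0 F i j.

End Tor.

Section Regularity.
Variables (k : fieldType) (A : comAlgType k) (G : std_grading A).

(* Suprema are taken in \bar int = int + {-oo, +oo}, with sup(empty) = -oo. *)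
Definition tdeg (N : graded_module G) (i : nat) : \bar int :=
  supremum -oo%E (EFin @` [set j : int | Tor_neq0 (residue_field G) N i j]).

Definition reg_upto (N : graded_module G) (n : nat) : \bar int :=
  \big[Order.max/-oo%E]_(i < n.+1) (tdeg N i - (i%:Z)%:E)%E.

Definition reg (N : graded_module G) : \bar int :=
  supremum -oo%E (range (reg_upto N)).

Definition koszul : Prop := reg (residue_field G) = 0%E.

End Regularity.

(* The Green-Lazarsfeld condition N_q for A/I over A. *)
Definition green_lazarsfeld (k : fieldType) (A : comAlgType k)
    (G : std_grading A) (I : idealr A) (hI : homogeneous G I) (q : nat) : Prop :=
  forall i : nat, (1 <= i <= q)%N ->
    tdeg (quot_module hI) i = (i.+1%:Z)%:E.

(* Main.v *)
(* Let F be a free resolution of k over S and K a minimal one over R = S/I,   *)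
(* and chase in the double complex K (x)_R (F (x)_S R).  Its rows compute     *)
(* Tor^S(k,R), its columns are exact up to k (x) F, whose homology            *)
(* Tor^S(k,k) sits on the diagonal because S is Koszul.  Since R_+ kills      *)
(* Tor^S(k,R), this yields, with t_r = t_r^R(k) and s_m = t_m^S(R),           *)
(*   s_i <= max (i, t_r + s_(i+1-r) for 2 <= r <= i+1),                       *)
(*   t_p <= max (p, t_(p-r) + s_(r-1) for 2 <= r <= p).                       *)
(* By N_q the second inequality gives t_p <= p for p <= q+1, and t_p <= p+1   *)
(* for p <= n+1 is the assumption on reg^R(k); the first inequality then      *)
(* bounds s_i by induction on i.                                              *)
Require Import Defs.
From HB Require Import structures.
From mathcomp Require Import all_boot all_order all_algebra.
From mathcomp Require Import boolp classical_sets constructive_ereal.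
From mathcomp Require Import zify.

Set Implicit Arguments.
Unset Strict Implicit.
Unset Printing Implicit Defensive.

Import Order.TTheory GRing.Theory Num.Theory.
Local Open Scope ring_scope.

(** Write t_r = t_r^R(k) and s_m = t_m^S(R). Put K_p (x) F_m (x) R in position (p, m). Taking
    homology along the rows first gives E^1_(p,m) = K_p (x) Tor_m^S(k,R); taking it along the
    columns first gives Tor^S(k,k), which vanishes in internal degrees above the homological one
    because S is Koszul. In such degrees every class of the first spectral sequence must die. Its
    differential d^1 is zero, since K is minimal and R_+ kills Tor^S(k,R). Hence a class of E_(0,i)
    is hit by some d^r with r >= 2 coming from E_(r,i+1-r), which bounds s_i; and a basis element of
    K_p, seen in E_(p,0), supports some d^r with r >= 2 into E_(p-r,r-1), which bounds t_p.

    The spectral sequence is replaced by explicit zigzags in a fixed internal degree j.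
    [chase_right] and [chase_left] are the inductive zigzags, [Fvanish_chase] and [basis_chase] the
    two conclusions, and [tor_quot_bound] and [res_deg_bound] their forms for K and F. The inputs
    are [minimal_resolution] for K, [null_homotopy] for the action of R_+, and [Fvanish_k_quot] for
    the passage to Tor^S(k,k). A bound t <= b is always expressed as vanishing in each degree above
    b. *)

(** * Homogeneous components in a graded group *)

Section Components.
Variables (J : choiceType) (V : zmodType) (H : J -> set V).
Hypothesis gH : is_grading H.

Definition decomposes (c : J -> V) (x : V) : Prop :=
  (forall j, H j (c j)) /\
  exists2 s : seq J, uniq s &
    (forall j, j \notin s -> c j = 0) /\ x = \sum_(j <- s) c j.

Lemma decomposes_ex x : exists c, decomposes c x.
Proof.
have [s [f [us Hf ->]]] := grading_span gH x.
exists (fun j => if j \in s then f j else 0).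
split; first exact: grading_if.
exists s => //; split=> [j /negPf->//|].
by rewrite !big_seq; apply: eq_bigr => j ->.
Qed.

Lemma decomposes_uniq c d x : decomposes c x -> decomposes d x -> c =1 d.
Proof.
move=> [Hc [s us [cs ->]]] [Hd [t ut [dt e]]] j.
apply/eqP; rewrite -subr_eq0; apply/eqP.
have [jst|] := boolP (j \in undup (s ++ t)); last first.
  rewrite mem_undup mem_cat negb_or => /andP[js jt].
  by rewrite cs // dt // subrr.
apply: (grading_indep gH (undup_uniq (s ++ t)) (f := fun j => c j - d j)) jst.
  by move=> i; apply: gradingB.
have := sum_mergeB c d us ut; rewrite e subrr => {2}->.
apply: eq_bigr => i _; congr (_ - _); case: ifP => // /negbT ni.
  exact: cs.
exact: dt.
Qed.

(** The decomposition is chosen classically; additivity comes from its uniqueness,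
    [decomposes_uniq]. *)
Definition component (j : J) (x : V) : V := projT1 (cid (decomposes_ex x)) j.

Lemma component_decomposes x : decomposes (component^~ x) x.
Proof. by rewrite /component; case: cid. Qed.

Lemma componentP j x : H j (component j x).
Proof. by case: (component_decomposes x). Qed.

Lemma component_hom i j x : H j x -> component i x = if i == j then x else 0.
Proof.
move=> Hx; apply: (decomposes_uniq (component_decomposes x)
  (d := fun i => if i == j then x else 0)); split=> [l|].
  by case: eqP => [->//|_]; apply: grading0.
exists [:: j] => //; split=> [l|]; last by rewrite big_seq1 eqxx.
by rewrite inE => /negPf->.
Qed.

Lemma componentD j : {morph component j : x y / x + y}.
Proof.
move=> x y; apply: (decomposes_uniq (component_decomposes (x + y))
  (d := fun j => component j x + component j y)).
have [Hx [s us [xs ex]]] := component_decomposes x.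
have [Hy [t ut [yt ey]]] := component_decomposes y.
split=> [i|]; first exact: gradingD.
exists (undup (s ++ t)); first exact: undup_uniq.
split=> [i|].
  rewrite mem_undup mem_cat negb_or => /andP[i_s i_t].
  by rewrite xs // yt // addr0.
rewrite {1}ex {1}ey big_split /=; congr (_ + _).
  rewrite (sum_extend _ us (undup_uniq (s ++ t))) => [|i]; last first.
    by rewrite mem_undup mem_cat => ->.
  by apply: eq_bigr => i _; case: ifP => // /negbT /xs.
rewrite (sum_extend _ ut (undup_uniq (s ++ t))) => [|i]; last first.
  by rewrite mem_undup mem_cat orbC => ->.
by apply: eq_bigr => i _; case: ifP => // /negbT /yt.
Qed.

Lemma component0 j : component j 0 = 0.
Proof. by rewrite (component_hom j (grading0 gH j)) eqxx. Qed.

Lemma component_sum (I : Type) (r : seq I) (P : pred I) (F : I -> V) j :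
  component j (\sum_(i <- r | P i) F i) =
  \sum_(i <- r | P i) component j (F i).
Proof. exact: (big_morph _ (componentD j) (component0 j)). Qed.

Lemma component_fin x : exists2 s : seq J, uniq s &
  forall t : seq J, uniq t -> {subset s <= t} ->
    x = \sum_(j <- t) component j x.
Proof.
have [_ [s us [xs ex]]] := component_decomposes x.
exists s => // t ut st; rewrite [LHS]ex (sum_extend _ us ut st).
by apply: eq_bigr => i _; case: ifP => // /negbT /xs.
Qed.

End Components.

(** Injectivity of the degree shift [sigma] keeps distinct components from merging. The maps of
    interest are multiplication by a homogeneous element, reduction modulo I, and a |-> a m with m
    homogeneous. *)
Lemma component_morph (J K : choiceType) (V W : zmodType)
    (H : J -> set V) (H' : K -> set W) (gH : is_grading H)
    (gH' : is_grading H') (phi : V -> W) (sigma : J -> K) j x :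
  {morph phi : x y / x + y} -> injective sigma ->
  (forall j x, H j x -> H' (sigma j) (phi x)) ->
  component gH' (sigma j) (phi x) = phi (component gH j x).
Proof.
move=> phiD sinj Hphi.
have phi0 : phi 0 = 0 by apply: (addIr (phi 0)); rewrite -phiD !add0r.
have [s us /(_ s us (fun=> id)) ex] := component_fin gH x.
rewrite [in LHS]ex [in RHS]ex.
rewrite (big_morph _ phiD phi0) !component_sum (big_morph _ phiD phi0).
apply: eq_bigr => i _.
rewrite (component_hom gH' _ (Hphi _ _ (componentP gH i x))).
rewrite (component_hom gH _ (componentP gH i x)) (inj_eq sinj).
by case: ifP.
Qed.

(** * Homogeneous elements and homogeneous matrices *)

Section HomogeneousElements.
Variables (k : fieldType) (A : comAlgType k) (G : std_grading A).
Implicit Types (i j : int) (a x y : A).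

Definition zgrading : is_grading (intpart G) :=
  intpart_grading (hpart_grading G).

Definition zcomp j x : A := component zgrading j x.

Lemma intpartM i j x y :
  intpart G i x -> intpart G j y -> intpart G (i + j) (x * y).
Proof.
have G0 := grading0 zgrading (i + j); move: G0.
case: i j => [i|i] [j|j] G0; first exact: hpartM.
- by move=> _ ->; rewrite mulr0.
- by move=> -> _; rewrite mul0r.
- by move=> -> _; rewrite mul0r.
Qed.

Lemma zcompM i j a x : intpart G i a -> zcomp (i + j) (a * x) = a * zcomp j x.
Proof.
move=> Ga; apply: (component_morph _ _ (sigma := fun j => i + j)).
- by move=> u v; rewrite mulrDr.
- exact: addrI.
- by move=> l u; apply: intpartM.
Qed.

Lemma zcomp_hom i j x : intpart G j x -> zcomp i x = if i == j then x else 0.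
Proof. exact: component_hom. Qed.

Lemma zcompP j x : intpart G j (zcomp j x).
Proof. exact: componentP. Qed.

Lemma hpart0P x : intpart G 0 x -> exists c : k, x = c%:A.
Proof.
by move=> Gx; have : G 0%N x by []; rewrite hpart_0 => -[c _ <-]; exists c.
Qed.

Lemma irrelevantE x : (x \in irrelevant G) = (zcomp 0 x == 0).
Proof.
apply/idP/eqP => [/asboolP[s [f [us s0 Gf ->]]]|x0].
  rewrite /zcomp component_sum big_seq big1 // => n ns.
  have Gn : intpart G n%:Z (f n) by apply: Gf.
  rewrite (component_hom _ _ Gn).
  by case: n ns {Gn} => // ns; rewrite ns in s0.
have [s us /(_ s us (fun=> id)) ex] := component_fin zgrading x.
rewrite ex; apply: irrelevant_sum => -[[|n]|n] _.
- by rewrite -/(zcomp 0 x) x0; apply: irrelevant0.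
- by apply: irrelevant_part; apply: (zcompP n.+1).
- have -> : component zgrading (Negz n) x = 0 by apply: (zcompP (Negz n)).
  exact: irrelevant0.
Qed.

Lemma irrelevant_hom j x : intpart G j x -> j != 0 -> x \in irrelevant G.
Proof.
move=> Gx j0; rewrite irrelevantE (zcomp_hom _ Gx).
by rewrite [0 == j]eq_sym (negPf j0).
Qed.

Lemma zcomp_irrelevant j x : x \in irrelevant G -> zcomp j x \in irrelevant G.
Proof.
have [->|j0] := eqVneq j 0; last first.
  by move=> _; apply: irrelevant_hom j0; apply: zcompP.
by rewrite !irrelevantE => /eqP ->; rewrite /zcomp component0.
Qed.

Lemma irrelevant_mull a x : x \in irrelevant G -> a * x \in irrelevant G.
Proof. exact: idealMr. Qed.

End HomogeneousElements.

Section HomogeneousMatrices.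
Variables (k : fieldType) (A : comAlgType k) (G : std_grading A).

(* A matrix of degree 0 from \bigoplus_r A(- dr r) to \bigoplus_c A(- dc c).  *)
Definition hommx m n (dr : 'I_m -> int) (dc : 'I_n -> int)
    (M : 'M[A]_(m, n)) : Prop :=
  forall r c, intpart G (dr r - dc c) (M r c).

Definition irrmx m n (M : 'M[A]_(m, n)) : Prop :=
  forall r c, M r c \in irrelevant G.

Let gG := zgrading G.

Lemma hommxB m n dr dc (M N : 'M[A]_(m, n)) :
  hommx dr dc M -> hommx dr dc N -> hommx dr dc (M - N).
Proof. by move=> hM hN r c; rewrite !mxE; apply: (gradingB gG). Qed.

Lemma hommxM m n p dr db dc (M : 'M[A]_(m, n)) (N : 'M[A]_(n, p)) :
  hommx dr db M -> hommx db dc N -> hommx dr dc (M *m N).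
Proof.
move=> hM hN r c; rewrite mxE.
apply: (big_ind (intpart G (dr r - dc c))) => [|x y|i _].
- exact: (grading0 gG).
- exact: (gradingD gG).
- by rewrite -(subrKA (db i)); apply: intpartM.
Qed.

(** Transposition dualises the free modules and so negates degrees; the common twist j lets the
    degree j part of a tensor product K_p (x) F_m be treated as homogeneous matrices. *)
Lemma hommx_tr m n (j : int) dr dc (M : 'M[A]_(m, n)) :
  hommx dr dc M -> hommx (fun c => j - dc c) (fun r => j - dr r) M^T.
Proof.
by move=> hM c r; rewrite mxE opprB addrC subrKA; apply: hM.
Qed.

Lemma hommx_row m n dr dc (M : 'M[A]_(m, n)) r :
  hommx dr dc M -> hommx (fun=> dr r) dc (row r M).
Proof. by move=> hM i c; rewrite mxE. Qed.

Lemma irrmxM m n p (M : 'M[A]_(m, n)) (N : 'M[A]_(n, p)) :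
  irrmx M -> irrmx (M *m N).
Proof.
by move=> hM r c; rewrite mxE; apply: irrelevant_sum => i _; rewrite mulrC;
  apply: irrelevant_mull.
Qed.

Lemma irrmx_tr m n (M : 'M[A]_(m, n)) : irrmx M -> irrmx M^T.
Proof. by move=> hM r c; rewrite mxE. Qed.

Definition rowcomp n (dc : 'I_n -> int) (j : int) (v : 'rV[A]_n) : 'rV[A]_n :=
  \row_c zcomp G (j - dc c) (v 0 c).

Lemma rowcomp_hom n dc j (v : 'rV[A]_n) : hommx (fun=> j) dc (rowcomp dc j v).
Proof. by move=> r c; rewrite mxE; apply: zcompP. Qed.

Lemma rowcomp_id n dc j (v : 'rV[A]_n) :
  hommx (fun=> j) dc v -> rowcomp dc j v = v.
Proof.
by move=> hv; apply/rowP => c; rewrite mxE (zcomp_hom _ (hv 0 c)) eqxx.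
Qed.

Lemma rowcompM n p db dc j (v : 'rV[A]_n) (M : 'M[A]_(n, p)) :
  hommx db dc M -> rowcomp dc j (v *m M) = rowcomp db j v *m M.
Proof.
move=> hM; apply/rowP => c; rewrite !mxE /zcomp component_sum.
apply: eq_bigr => i _; rewrite mxE [LHS]/(zcomp _ _ _) mulrC.
have -> : j - dc c = (db i - dc c) + (j - db i) by rewrite [RHS]addrC subrKA.
by rewrite [RHS]mulrC; apply: zcompM; apply: hM.
Qed.

Lemma rowcomp_fin n dc (v : 'rV[A]_n) : exists2 s : seq int, uniq s &
  forall t : seq int, uniq t -> {subset s <= t} ->
    v = \sum_(j <- t) rowcomp dc j v.
Proof.
have h (c : 'I_n) : { s : seq int | uniq s & forall t : seq int, uniq t ->
    {subset s <= t} -> v 0 c = \sum_(j <- t) zcomp G j (v 0 c) }.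
  exact: cid2 (component_fin gG (v 0 c)).
pose S c := [seq j + dc c | j <- s2val (h c)].
exists (undup (flatten [seq S c | c : 'I_n])); first exact: undup_uniq.
move=> t ut st; apply/rowP => c; rewrite summxE.
under eq_bigr do rewrite mxE.
rewrite -(big_map (fun j => j - dc c) xpredT (fun j => zcomp G j (v 0 c))).
apply: (s2valP' (h c)) => [|l ls].
  by rewrite map_inj_uniq //; apply: addIr.
apply/mapP; exists (l + dc c); last by rewrite addrK.
apply: st; rewrite mem_undup; apply/flattenP; exists (S c).
  by apply/mapP; exists c; rewrite ?mem_enum.
exact: map_f.
Qed.

End HomogeneousMatrices.

(** * Finite generation over Noetherian rings *)

Definition submodule (A : pzRingType) n (P : 'rV[A]_n -> Prop) : Prop :=
  P 0 /\ forall a u v, P u -> P v -> P (a *: u + v).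

Lemma submodule_mul (A : pzRingType) m n (P : 'rV[A]_n -> Prop)
    (w : 'rV[A]_m) (M : 'M[A]_(m, n)) :
  submodule P -> (forall i, P (row i M)) -> P (w *m M).
Proof.
move=> [P0 PD] PM; rewrite mulmx_sum_row.
by elim/big_rec: _ => // i v _ Pv; apply: PD.
Qed.

(** Induction on n: the first coordinates of P form an ideal, whose generators lift to the rows of
    [U]; subtracting a combination of these leaves a vector with zero first coordinate, covered by
    the induction hypothesis. *)
Lemma noetherian_rV (A : comNzRingType) n (P : 'rV[A]_n -> Prop) :
  noetherian A -> submodule P ->
  exists m (M : 'M[A]_(m, n)), forall v, P v <-> exists w, v = w *m M.
Proof.
move=> noeA; elim: n P => [P [P0 _]|n IHn].
  exists 0%N, 0 => v; split=> [_|_]; last by rewrite [v]thinmx0.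
  by exists 0; rewrite [v]thinmx0 mul0mx.
rewrite -[n.+1]/(1 + n)%N => P sP; have [P0 PD] := sP.
pose J : {pred A^o} := fun a : A =>
  `[< exists2 v : 'rV[A]_(1 + n), P v & v 0 0 = a >].
have [|s sJ Js] := noeA J.
  split; first by apply/asboolP; exists 0; rewrite ?mxE.
  move=> a x y /asboolP[u Pu <-] /asboolP[v Pv <-].
  by apply/asboolP; exists (a *: u + v); [apply: PD|rewrite !mxE].
have hv (i : 'I_(size s)) : { v : 'rV[A]_(1 + n) | P v & v 0 0 = s`_i }.
  by apply: cid2; apply/asboolP/sJ; apply: mem_nth.
have [|N [M MP]] := IHn (fun u => P (row_mx (0 : 'rV_1) u)).
  split; first by rewrite row_mx0.
  move=> a u v Pu Pv.
  have e : a *: row_mx (0 : 'rV_1) u + row_mx 0 v = row_mx 0 (a *: u + v).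
    by rewrite scale_row_mx add_row_mx scaler0 addr0.
  by rewrite -e; apply: (PD a _ _ Pu Pv).
pose U : 'M[A]_(size s, 1 + n) := \matrix_i s2val (hv i).
exists (size s + N)%N, (col_mx U (row_mx 0 M)) => v.
split=> [Pv|[w ->]]; last first.
  apply: (submodule_mul _ sP) => i; case: (split_ordP i) => l ->.
    by rewrite rowKu rowK; apply: (s2valP (hv l)).
  rewrite rowKd row_row_mx row0; apply/MP; exists (delta_mx 0 l).
  by rewrite rowE.
have [|c ec] := Js (v 0 0); first by apply/asboolP; exists v.
pose a : 'rV[A]_(size s) := \row_i c i.
pose v' := v - a *m U.
have Pv' : P v'.
  rewrite /v' -scaleN1r addrC; apply: PD => //.
  apply: (submodule_mul _ sP) => i.
  by rewrite rowK; apply: (s2valP (hv i)).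
have v'0 : lsubmx v' = 0.
  apply/rowP => i; rewrite !mxE [lshift n i](_ : _ = 0); last first.
    by apply: val_inj; rewrite /= ord1.
  rewrite ec; apply/eqP; rewrite subr_eq0; apply/eqP/eq_bigr => l _.
  by rewrite !mxE (s2valP' (hv l)).
have [w ew] : exists w, rsubmx v' = w *m M.
  by apply/MP; rewrite -v'0 hsubmxK.
exists (row_mx a w); rewrite mul_row_col mul_mx_row mulmx0.
by rewrite -ew -v'0 hsubmxK /v' addrC subrK.
Qed.

Lemma noetherian_quot (k : fieldType) (A : comAlgType k) (I : idealr A) :
  noetherian A -> noetherian (quot_alg I).
Proof.
move=> noeA J [J0 JD].
pose J' : {pred A^o} := fun a : A => quot_pi I a \in J.
have [|s sJ Js] := noeA J'.
  split; first by rewrite unfold_in raddf0.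
  move=> a x y; rewrite !unfold_in => Jx Jy.
  by rewrite raddfD /= rmorphM; apply: JD.
exists (map (quot_pi I) s) => [_ /mapP[a /sJ Ja ->]//|y Jy].
have [x xy] := quot_pi_surj y.
have [|c ex] := Js x; first by rewrite unfold_in xy.
exists (fun i => quot_pi I (c i)); rewrite -xy ex size_map raddf_sum.
by apply: eq_bigr => i _; rewrite (nth_map 0) //; apply: rmorphM.
Qed.

Lemma submodule_sum (A : pzRingType) n (P : 'rV[A]_n -> Prop)
    (I : eqType) (s : seq I) (F : I -> 'rV[A]_n) :
  submodule P -> (forall i, i \in s -> P (F i)) -> P (\sum_(i <- s) F i).
Proof.
move=> [P0 PD] PF; rewrite big_seq; elim/big_rec: _ => // i v /PF Pi Pv.
by rewrite -[F i]scale1r; apply: PD.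
Qed.

Lemma submodule_rowspace (A : pzRingType) m n (M : 'M[A]_(m, n)) :
  submodule (fun v => exists w, v = w *m M).
Proof.
split=> [|a _ _ [u ->] [v ->]]; first by exists 0; rewrite mul0mx.
by exists (a *: u + v); rewrite mulmxDl scalemxAl.
Qed.

(** * Minimal generators and the minimal resolution of k *)

Section MinimalGenerators.
Variables (k : fieldType) (A : comAlgType k) (G : std_grading A).
Hypothesis noeA : noetherian A.
Variables (n : nat) (dc : 'I_n -> int) (P : 'rV[A]_n -> Prop).
Hypotheses (sP : submodule P)
  (hP : forall j v, P v -> P (rowcomp G dc j v)).

Definition hom_generators m : Prop :=
  exists (M : 'M[A]_(m, n)) (d : 'I_m -> int), hommx G d dc M /\
    forall v, P v <-> exists w, v = w *m M.

(** The homogeneous components of finitely many generators lie in P and generate it; [T] is a finite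
    list of degrees that suffices for all generators at once. *)
Lemma hom_generators_ex : exists m, hom_generators m.
Proof.
have [a [M MP]] := noetherian_rV noeA sP.
have h (i : 'I_a) : { s : seq int | uniq s & forall t : seq int, uniq t ->
    {subset s <= t} -> row i M = \sum_(j <- t) rowcomp G dc j (row i M) }.
  exact: cid2 (rowcomp_fin G dc (row i M)).
pose T := undup (flatten [seq s2val (h i) | i : 'I_a]).
pose X := ('I_a * 'I_(size T))%type.
pose ev (x : 'I_#|{: X}|) : X := enum_val x.
exists #|{: X}|, (\matrix_x rowcomp G dc T`_(ev x).2 (row (ev x).1 M)).
exists (fun x => T`_(ev x).2).
split=> [x c|v]; first by rewrite mxE; apply: rowcomp_hom.
split=> [/MP[w ->]|[w ->]]; last first.
  apply: (submodule_mul _ sP) => x; rewrite rowK; apply/hP/MP.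
  by exists (delta_mx 0 (ev x).1); rewrite rowE.
apply: (submodule_mul _ (submodule_rowspace _)) => i.
rewrite [row i M](s2valP' (h i) T) ?undup_uniq // => [|j ji]; last first.
  rewrite mem_undup; apply/flattenP; exists (s2val (h i)) => //.
  by apply/mapP; exists i; rewrite ?mem_enum.
apply: (submodule_sum (submodule_rowspace _)) => j jT.
have jT' : (index j T < size T)%N by rewrite index_mem.
exists (delta_mx 0 (enum_rank ((i, Ordinal jT') : X))).
by rewrite -rowE rowK /ev enum_rankK /= nth_index.
Qed.

(* Minimality of the number of generators: a relation with a coefficient      *)
(* outside A_+ has one with a nonzero scalar coefficient, which allows to     *)
(* drop a generator.                                                          *)
Lemma min_generators : exists m (M : 'M[A]_(m, n)) (d : 'I_m -> int),
  [/\ hommx G d dc M, forall v, P v <-> exists w, v = w *m M &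
      forall w : 'rV[A]_m, w *m M = 0 -> irrmx G w].
Proof.
have ex : exists m, `[< hom_generators m >].
  by have [m hm] := hom_generators_ex; exists m; apply/asboolP.
case: (ex_minnP ex) => m /asboolP[M [d [hM MP]]] mmin.
exists m, M, d; split=> // w wM r c; rewrite ord1 {r}; apply/negPn/negP => wc.
case: m M d hM MP mmin w wM c wc => [|m] M d hM MP mmin w wM c wc.
  by case: c {wc}.
suff /mmin : `[< hom_generators m >] by rewrite ltnn.
apply/asboolP; exists (row' c M), (d \o lift c); split=> [r j|v].
  by rewrite mxE; apply: hM.
have rM i : P (row i M) by apply/MP; exists (delta_mx 0 i); rewrite rowE.
split=> [/MP[u ->]|[u ->]]; last first.
  apply: (submodule_mul _ sP) => i.
  by rewrite (_ : row i _ = row (lift c i) M) //; apply/rowP => j; rewrite !mxE.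
have spanl l : row (lift c l) M = delta_mx 0 l *m row' c M.
  by rewrite -rowE; apply/rowP => j; rewrite !mxE.
apply: (submodule_mul _ (submodule_rowspace _)) => i.
have [l ->|->] := unliftP c i; first by exists (delta_mx 0 l).
pose w' := rowcomp G d (d c) w.
have w'M : w' *m M = 0.
  rewrite -(rowcompM _ _ hM) wM; apply/rowP => j.
  by rewrite !mxE /zcomp component0.
have w'c : w' 0 c = zcomp G 0 (w 0 c) by rewrite mxE subrr.
have [a wa] := hpart0P (zcompP G 0 (w 0 c)).
have a0 : a != 0.
  by apply: contraNneq wc => a0; rewrite irrelevantE wa a0 scale0r.
move: w'M; rewrite mulmx_sum_row (bigD1_ord c) //= w'c wa => /eqP.
rewrite addr_eq0 => /eqP /(congr1 (fun v => (a^-1)%:A *: v)).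
rewrite scalerA -scalerAl mul1r scalerA mulVf // scale1r scale1r => ->.
exists (\sum_l - ((a^-1)%:A * w' 0 (lift c l)) *: delta_mx 0 l).
rewrite mulmx_suml scalerN -scaleNr scaler_sumr; apply: eq_bigr => l _.
by rewrite scalerA -scalemxAl -spanl mulNr.
Qed.

End MinimalGenerators.

Section MinimalResolution.
Variables (k : fieldType) (A : comAlgType k) (G : std_grading A).
Hypothesis noeA : noetherian A.

Record generators n (dc : 'I_n -> int) (P : 'rV[A]_n -> Prop) := Generators {
  gen_rank : nat;
  gen_mx : 'M[A]_(gen_rank, n);
  gen_deg : 'I_gen_rank -> int;
  gen_hom : hommx G gen_deg dc gen_mx;
  gen_span : forall v, P v <-> exists w, v = w *m gen_mx;
  gen_min : forall w : 'rV[A]_gen_rank, w *m gen_mx = 0 -> irrmx G w }.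

Lemma generators_inhabited n (dc : 'I_n -> int) (P : 'rV[A]_n -> Prop) :
  submodule P -> (forall j v, P v -> P (rowcomp G dc j v)) ->
  inhabited (generators dc P).
Proof.
move=> sP hP; have [m [M [d [hM MP Mmin]]]] := min_generators noeA sP hP.
exact: inhabits (Generators hM MP Mmin).
Qed.

Lemma irrmx_submodule n : submodule (fun v : 'rV[A]_n => irrmx G v).
Proof.
split=> [r c|a u v hu hv r c]; first by rewrite mxE; apply: irrelevant0.
by rewrite !mxE rpredD ?irrelevant_mull.
Qed.

Lemma irrmx_rowcomp n (dc : 'I_n -> int) j v :
  irrmx G v -> irrmx G (rowcomp G dc j v).
Proof. by move=> hv r c; rewrite mxE; apply: zcomp_irrelevant. Qed.

Lemma kermx_submodule m n (M : 'M[A]_(m, n)) :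
  submodule (fun v : 'rV[A]_m => v *m M = 0).
Proof.
split=> [|a u v hu hv]; first by rewrite mul0mx.
by rewrite mulmxDl -scalemxAl hu hv scaler0 addr0.
Qed.

Lemma kermx_rowcomp m n dr dc (M : 'M[A]_(m, n)) j v : hommx G dr dc M ->
  v *m M = 0 -> rowcomp G dr j v *m M = 0.
Proof.
move=> hM vM; rewrite -(rowcompM _ _ hM) vM; apply/rowP => c.
by rewrite !mxE /zcomp component0.
Qed.

(** One stage of the resolution: the free module F_i with its degrees, the submodule that the next
    differential must have as image, and minimal generators of it, which are the rows of that
    differential. The first submodule is A_+ in A, the later ones are kernels. *)
Record node := Node {
  node_rank : nat;
  node_deg : 'I_node_rank -> int;
  node_sub : 'rV[A]_node_rank -> Prop;
  node_gen : generators node_deg node_sub }.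

Definition first_node : node := Node (inhabited_witness
  (generators_inhabited (dc := fun _ : 'I_1 => 0)
    (irrmx_submodule 1) (@irrmx_rowcomp _ _))).

Definition next_node (s : node) : node := Node (inhabited_witness
  (generators_inhabited (kermx_submodule (gen_mx (node_gen s)))
    (fun j v => kermx_rowcomp (v := v) j (gen_hom (g := node_gen s))))).

Definition nodes (i : nat) : node := iter i next_node first_node.

Definition res1 : residue_field G := quot_pi (irrelevant G) 1.

Lemma res1_scale (a : A) : a *: res1 = quot_pi (irrelevant G) a.
Proof.
transitivity (quot_pi (irrelevant G) a * quot_pi (irrelevant G) 1).
  by [].
by rewrite -rmorphM mulr1.
Qed.

Lemma minimal_resolution : exists F : free_resolution (residue_field G),
  [/\ forall i, irrmx G (res_diff F i),
      forall c : 'I_(res_rank F 0), res_deg c = 0,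
      (0 < res_rank F 0)%N &
      forall v : 'rV_(res_rank F 0),
        (exists w, v = w *m res_diff F 0) <-> irrmx G v].
Proof.
have sum1 (v : 'rV[A]_1) :
    \sum_c v 0 c *: res1 = quot_pi (irrelevant G) (v 0 0).
  by rewrite big_ord1 res1_scale.
have irr1 (v : 'rV[A]_1) : irrmx G v <-> v 0 0 \in irrelevant G.
  by split=> [/(_ 0 0)|h r c] //; rewrite !ord1.
have span0 (v : 'rV[A]_1) : irrmx G v <->
    exists w, v = w *m gen_mx (node_gen first_node).
  exact: (gen_span (node_gen first_node)).
unshelve eexists (@FreeResolution _ _ _ _ (node_rank \o nodes)
  (fun i => node_deg (n := nodes i)) (fun i => gen_mx (node_gen (nodes i)))
  (fun=> res1) _ _ _ _ _).
- by move=> i; apply: gen_hom.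
- by move=> c; exists 1; [rewrite hpart_0; exists 1; rewrite ?scale1r|].
- move=> m; have [x <-] := quot_pi_surj m.
  by exists (\row_(c < 1) x); rewrite sum1 mxE.
- by move=> v; rewrite sum1 quot_pi_eq0 -irr1; apply: span0.
- by move=> i v; apply: (gen_span (node_gen (nodes i.+1))).
split=> //= [i|v]; last by rewrite span0.
(* The rows of a differential lie in [node_sub]: this is A_+ itself at stage 0, and afterwards
   consists of relations among minimal generators, whose coefficients are in A_+ by [gen_min]. *)
suff h j : node_sub (row j (gen_mx (node_gen (nodes i)))) ->
    irrmx G (row j (gen_mx (node_gen (nodes i)))).
  move=> r c; rewrite (_ : _ r c = row r (gen_mx (node_gen (nodes i))) 0 c).
    apply: h; apply/gen_span.
    by exists (delta_mx 0 r); rewrite rowE.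
  by rewrite [RHS]mxE.
by case: i j => [|i] j //; apply: gen_min.
Qed.

End MinimalResolution.

Section MinimalTor.
Variables (k : fieldType) (A : comAlgType k) (G : std_grading A).

Lemma irrelevant_scale (a : A) (y : residue_field G) :
  a \in irrelevant G -> a *: y = 0.
Proof.
move=> Ga; have [x <-] := quot_pi_surj y.
transitivity (quot_pi (irrelevant G) (a * x)); first by rewrite rmorphM.
by apply/quot_pi_eq0; rewrite mulrC irrelevant_mull.
Qed.

Lemma res1_neq0 : res1 G <> 0.
Proof. by move/quot_pi_eq0; rewrite idealr1. Qed.

(** Tensoring a minimal resolution with k makes all differentials zero, so each basis element
    survives in homology. *)
Lemma minimal_Tor_neq0 (F : free_resolution (residue_field G)) p
    (c : 'I_(res_rank F p)) : (forall i, irrmx G (res_diff F i)) ->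
  Tor_neq0 (residue_field G) (residue_field G) p (res_deg c).
Proof.
move=> Fmin.
have diff0 i (z : tens (residue_field G) F i.+1) b : tens_diff z b = 0.
  by rewrite /tens_diff big1 // => r _; apply: irrelevant_scale; apply: Fmin.
exists F, (fun b => if b == c then res1 G else 0); split.
- move=> b; case: eqP => [->|_]; last exact: (grading0 (gm_grading _)).
  by rewrite subrr; exists 1; [rewrite hpart_0; exists 1; rewrite ?scale1r|].
- by case: p c => [//|p] c b; apply: diff0.
- by case=> w _ /(_ c); rewrite diff0 eqxx => /esym/res1_neq0.
Qed.

End MinimalTor.

(** * Suprema in the extended integers, and regularity *)

Section Suprema.
Local Open Scope ereal_scope.

(** [supremum] picks an element of [supremums], so it is known to be an upper bound once this set is
    nonempty. A set bounded by an integer b and containing an integer has a maximum, found as b - m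
    with m least. *)
Lemma supremums_ereal_int (E : set (\bar int)) : (supremums E !=set0)%classic.
Proof.
have [[b ubE]|nub] := pselect (exists b : int, ubound E b%:E); last first.
  exists +oo; split=> [x _|y ubE]; first exact: leey.
  case: y ubE => [r ubE|//|ubE]; first by case: nub; exists r.
  case: nub; exists 0%R; move=> x /ubE.
  by rewrite leeNy_eq => /eqP ->; apply: leNye.
have [[a Ea]|nE] := pselect (exists a : int, E a%:E); last first.
  exists -oo; split=> [x Ex|y _]; last exact: leNye.
  case: x Ex => [r Er|Ep|//]; first by case: nE; exists r.
  by have := ubE _ Ep; rewrite leye_eq.
pose S (n : nat) := `[< E (b - n%:Z)%R%:E >].
have exS : exists n, S n.
  have ab : (a <= b)%R by rewrite -lee_fin; apply: ubE.
  exists `|b - a|%N; apply/asboolP; rewrite gez0_abs ?subr_ge0 //.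
  by rewrite opprB addrC subrK.
case: (ex_minnP exS) => m /asboolP Em mmin.
exists (b - m%:Z)%R%:E; split=> [x Ex|y /(_ _ Em)//].
case: x Ex => [r Er|Ep|_]; last exact: leNye.
  have rb : (r <= b)%R by rewrite -lee_fin; apply: ubE.
  have /mmin : S `|b - r|%N.
    by apply/asboolP; rewrite gez0_abs ?subr_ge0 // opprB addrC subrK.
  rewrite lee_fin; lia.
by have := ubE _ Ep; rewrite leye_eq.
Qed.

Lemma supremum_ub (E : set (\bar int)) x : E x -> x <= supremum -oo E.
Proof. exact: ge_supremum_Nmem (supremums_ereal_int E). Qed.

Lemma supremum_le (E : set (\bar int)) y :
  (forall x, E x -> x <= y) -> supremum -oo E <= y.
Proof.
move=> hy; rewrite /supremum; case: ifP => _; first exact: leNye.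
by case: xgetP => [x _ [_]|_]; [apply|apply: leNye].
Qed.

End Suprema.

Section Regularity.
Variables (k : fieldType) (A : comAlgType k) (G : std_grading A).
Variable N : graded_module G.

Lemma tdeg_le i (b : int) :
  (forall j, Tor_neq0 (residue_field G) N i j -> j <= b) ->
  (tdeg N i <= b%:E)%E.
Proof. by move=> h; apply: supremum_le => _ [j /h jb <-]; rewrite lee_fin. Qed.

Lemma Tor_neq0_le i j (b : int) :
  (tdeg N i <= b%:E)%E -> Tor_neq0 (residue_field G) N i j -> j <= b.
Proof.
move=> tb Tj; rewrite -lee_fin; apply: le_trans tb.
by apply: supremum_ub; exists j.
Qed.

Lemma tdeg_reg_upto n i (b : int) : (i <= n)%N ->
  (reg_upto N n <= b%:E)%E -> (tdeg N i <= (i%:Z + b)%:E)%E.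
Proof.
move=> le_in; rewrite -ltnS in le_in.
move=> regb; have : (tdeg N i - i%:Z%:E <= b%:E)%E.
  apply: le_trans regb; rewrite /reg_upto.
  exact: (le_bigmax _ _ (Ordinal le_in)).
by rewrite leeBlDr // EFinD addeC.
Qed.

Lemma reg_upto_reg n : (reg_upto N n <= reg N)%E.
Proof. by apply: supremum_ub; exists n. Qed.

End Regularity.

(** Any solution of a homogeneous linear system can be replaced by its component of the right
    degree. *)
Lemma hom_solve (k : fieldType) (A : comAlgType k) (G : std_grading A)
    m n p dr db dc (X : 'M[A]_(m, p)) (D : 'M[A]_(n, p)) :
  hommx G db dc D -> hommx G dr dc X ->
  (forall r, exists w, row r X = w *m D) ->
  exists2 Y : 'M[A]_(m, n), hommx G dr db Y & X = Y *m D.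
Proof.
move=> hD hX h; have [w wP] := choice h.
exists (\matrix_r rowcomp G db (dr r) (w r)) => [r c|].
  by rewrite mxE; apply: (rowcomp_hom G db (dr r) (w r) 0).
apply/row_matrixP => r; rewrite row_mul rowK -(rowcompM _ _ hD) -wP.
by rewrite rowcomp_id //; apply: hommx_row.
Qed.

(** * Diagram chases in the double complex *)

Section DoubleComplex.
Variables (k : fieldType) (R : comAlgType k) (G : std_grading R).
Variables (g f : nat -> nat).
Variables (dg : forall p, 'I_(g p) -> int) (df : forall m, 'I_(f m) -> int).
Variables (DG : forall p, 'M[R]_(g p.+1, g p)).
Variables (DF : forall m, 'M[R]_(f m.+1, f m)).
Hypothesis DG_hom : forall p, hommx G (@dg p.+1) (@dg p) (DG p).
Hypothesis DF_hom : forall m, hommx G (@df m.+1) (@df m) (DF m).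
Hypothesis DGDG : forall p, DG p.+1 *m DG p = 0.
Hypothesis DFDF : forall m, DF m.+1 *m DF m = 0.
Hypothesis DG_exact : forall p (v : 'rV_(g p.+1)),
  v *m DG p = 0 -> exists w, v = w *m DG p.+1.
Hypothesis DG_exact0 : forall v : 'rV_(g 0),
  irrmx G v -> exists w, v = w *m DG 0.
Hypothesis DG_min : forall p, irrmx G (DG p).
Hypothesis dg0 : forall c, @dg 0 c = 0.

(* Let K and F be the complexes with differentials DG and DF.  An element of  *)
(* K_p (x) F_m is a g p x f m matrix, and the two differentials are the left  *)
(* multiplication by (DG p)^T and the right multiplication by DF m.           *)
Definition homdc (j : int) p m (X : 'M[R]_(g p, f m)) : Prop :=
  hommx G (fun r => j - dg r) (@df m) X.

Definition Fcycle a m : 'M[R]_(a, f m) -> Prop :=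
  match m with
  | 0 => fun=> True
  | m'.+1 => fun X => X *m DF m' = 0
  end.

(* H_m(F)_j = 0 *)
Definition Fvanish m (j : int) : Prop := forall X : 'rV[R]_(f m),
  hommx G (fun=> j) (@df m) X -> Fcycle X -> exists W, X = W *m DF m.

(* (K_p (x) H_m(F))_j = 0 *)
Definition E1vanish p m (j : int) : Prop :=
  forall c : 'I_(g p), Fvanish m (j - dg c).

(* H_(m+1)(F (x) k)_j = 0 *)
Definition Fvanish_k m (j : int) : Prop := forall X : 'rV[R]_(f m.+1),
  hommx G (fun=> j) (@df m.+1) X -> irrmx G (X *m DF m) ->
  exists2 W, hommx G (fun=> j) (@df m.+2) W & irrmx G (X - W *m DF m.+1).

Let DGDGt p : (DG p)^T *m (DG p.+1)^T = 0.
Proof. by rewrite -trmx_mul DGDG trmx0. Qed.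

Lemma FcycleM a b m (L : 'M_(a, b)) (X : 'M_(b, f m)) :
  Fcycle X -> Fcycle (L *m X).
Proof. by case: m X => //= m X hX; rewrite -mulmxA hX mulmx0. Qed.

Lemma Fcycle_boundary a m (X : 'M_(a, f m.+1)) : Fcycle (X *m DF m).
Proof. by case: m X => //= m X; rewrite -mulmxA DFDF mulmx0. Qed.

Lemma homdc_d1 j p m (X : 'M_(g p.+1, f m)) :
  homdc j X -> homdc j ((DG p)^T *m X).
Proof. by move=> hX; apply: (hommxM (hommx_tr j (@DG_hom p)) hX). Qed.

Lemma homdc_d2 j p m (X : 'M_(g p, f m.+1)) : homdc j X -> homdc j (X *m DF m).
Proof. by move=> hX; apply: (hommxM hX (@DF_hom m)). Qed.

Lemma d2_exact j p m (X : 'M_(g p, f m)) : homdc j X -> Fcycle X ->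
  E1vanish p m j -> exists2 Y : 'M_(g p, f m.+1), homdc j Y & X = Y *m DF m.
Proof.
move=> hX cX van; have [|Y hY eY] := hom_solve (@DF_hom m) hX; last by exists Y.
by move=> r; apply: van (hommx_row r hX) _; rewrite rowE; apply: FcycleM.
Qed.

Let d1_solve j p m (X : 'M_(g p, f m)) : homdc j X ->
  (forall c, exists w, row c X^T = w *m DG p) ->
  exists2 Y : 'M_(g p.+1, f m), homdc j Y & X = (DG p)^T *m Y.
Proof.
move=> hX h; have hXt : hommx G (fun c => j - df c) (@dg p) X^T.
  by move=> c r; rewrite mxE addrAC; apply: hX.
have [Y hY eY] := hom_solve (@DG_hom p) hXt h.
exists Y^T; last by rewrite -trmx_mul -eY trmxK.
by move=> r c; rewrite mxE addrAC; apply: hY.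
Qed.

Lemma d1_exact j p m (X : 'M_(g p.+1, f m)) : homdc j X ->
  (DG p)^T *m X = 0 ->
  exists2 Y : 'M_(g p.+2, f m), homdc j Y & X = (DG p.+1)^T *m Y.
Proof.
move=> hX X0; apply: d1_solve => // c; apply: DG_exact.
by rewrite -row_mul -[DG p]trmxK -trmx_mul X0 trmx0 row0.
Qed.

Lemma d1_exact0 j m (X : 'M_(g 0, f m)) : homdc j X -> irrmx G X ->
  exists2 Y : 'M_(g 1, f m), homdc j Y & X = (DG 0)^T *m Y.
Proof.
move=> hX iX; apply: d1_solve => // c; apply: DG_exact0 => r s.
by rewrite !mxE.
Qed.

(** Induction on i. As (DG r)^T V is a row cycle, V DF is a column cycle, hence (DG r.+1)^T V' with
    V' one step further along the antidiagonal. Decomposing V' provides U for which V - (DG r.+1)^T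
    U is a row cycle, hence a row boundary. *)
Lemma chase_right j i r (V : 'M_(g r.+1, f i)) : homdc j V ->
  Fcycle ((DG r)^T *m V) ->
  (forall r' m, (r < r')%N -> (r' + m = r.+1 + i)%N -> E1vanish r' m j) ->
  exists (U : 'M_(g r.+2, f i)) (W : 'M_(g r.+1, f i.+1)),
    [/\ homdc j U, homdc j W & V = (DG r.+1)^T *m U + W *m DF i].
Proof.
elim: i r V => [|i IHi] r V hV cV van.
  have [//|//||W hW ->] := @d2_exact j _ _ V.
    exact: van.
  exists 0, W; rewrite mulmx0 add0r; split=> // a b; rewrite mxE.
  exact: (grading0 (zgrading G)).
have [||V' hV' eV'] := @d1_exact j _ _ (V *m DF i).
- exact: homdc_d2.
- by rewrite mulmxA.
have [|r' m rr' e|U' [U [hU' hU eU]]] := IHi r.+1 V' hV'.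
- by rewrite -eV'; apply: Fcycle_boundary.
- by apply: van; [apply: ltnW|rewrite e addSnnS].
have eVU : V *m DF i = (DG r.+1)^T *m U *m DF i.
  by rewrite eV' eU mulmxDr mulmxA DGDGt mul0mx add0r mulmxA.
have [|||W hW eW] := @d2_exact j _ _ (V - (DG r.+1)^T *m U).
- by apply: hommxB => //; apply: homdc_d1.
- by rewrite /= mulmxBl eVU subrr.
- exact: van.
exists U, W; split=> //; first by rewrite -eW addrC subrK.
Qed.

(** Cycles of the augmented column K (x) F_m -> k (x) F_m: in position 0 the condition is to vanish
    in k (x) F_m. *)
Definition d2_irr p m : 'M[R]_(g p, f m) -> Prop :=
  match p with
  | 0 => irrmx G (n := f m)
  | p'.+1 => fun X => (DG p')^T *m X = 0
  end.

Lemma d2_irr_boundary p m (X : 'M_(g p.+1, f m)) : d2_irr ((DG p)^T *m X).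
Proof.
case: p X => /= [X|p X]; first exact/irrmxM/irrmx_tr.
by rewrite mulmxA DGDGt mul0mx.
Qed.

(** The zigzag opposite to [chase_right], by induction on p. It moves towards column position 0,
    where Y defines a cycle of k (x) F and the vanishing of H_(m+p+1)(k (x) F)_j ends it. *)
Lemma chase_left j p m (Y : 'M_(g p, f m.+1)) : homdc j Y ->
  d2_irr (Y *m DF m) -> Fvanish_k (m + p) j ->
  (forall p' m', (p' < p)%N -> (p' + m' = p + m)%N -> E1vanish p' m' j) ->
  exists (C : 'M_(g p.+1, f m.+1)) (W : 'M_(g p, f m.+2)),
    [/\ homdc j C, homdc j W & Y = (DG p)^T *m C + W *m DF m.+1].
Proof.
elim: p m Y => [|p IHp] m Y hY cY; rewrite ?addn0 => vank van.
  have h r : exists w : 'rV_(f m.+2),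
      hommx G (fun=> j) (@df m.+2) w /\ irrmx G (row r Y - w *m DF m.+1).
    have [||w hw iw] := vank (row r Y); last by exists w.
      by have := hommx_row r hY; rewrite /= dg0 subr0.
    by rewrite -row_mul => a b; rewrite mxE.
  have [w wP] := choice h; pose W := \matrix_r w r.
  have hW : homdc j W.
    by move=> r c; rewrite mxE dg0 subr0; apply: (proj1 (wP r)).
  have [||C hC eC] := @d1_exact0 j _ (Y - W *m DF m.+1).
  - by apply: hommxB => //; apply: homdc_d2.
  - move=> r c; have := proj2 (wP r) 0 c.
    by rewrite -[w r](rowK w) -row_mul !mxE.
  by exists C, W; rewrite -eC subrK.
have [|||Y' hY' eY'] := @d2_exact j _ _ ((DG p)^T *m Y).
- exact: homdc_d1.
- by rewrite /= -mulmxA.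
- by apply: van => //; rewrite addSnnS.
have [||p' m' pp' e|C [W [hC hW eY]]] := IHp m.+1 Y' hY'.
- by rewrite -eY'; apply: d2_irr_boundary.
- by rewrite addSnnS.
- by apply: van; [apply: ltnW|rewrite e addSnnS].
have eYC : (DG p)^T *m Y = (DG p)^T *m (C *m DF m.+1).
  by rewrite eY' eY mulmxDl -(mulmxA W) DFDF mulmx0 addr0 mulmxA.
have [||D hD eD] := @d1_exact j _ _ (Y - C *m DF m.+1).
- by apply: hommxB => //; apply: homdc_d2.
- by rewrite mulmxBr eYC subrr.
by exists D, C; rewrite -eD subrK.
Qed.

Hypothesis DF_null : forall m x (X : 'rV_(f m)),
  x \in irrelevant G -> Fcycle X -> exists W, x *: X = W *m DF m.

Lemma irr_cycle_boundary a m (x : 'rV_a) (X : 'M_(a, f m)) :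
  irrmx G x -> Fcycle X -> exists W, x *m X = W *m DF m.
Proof.
move=> ix cX; rewrite mulmx_sum_row.
apply: (submodule_sum (submodule_rowspace (DF m))) => r _.
by apply: DF_null => //; rewrite rowE; apply: FcycleM.
Qed.

(** Modulo a boundary, the cycle z is zero in k (x) F, hence is (DG 0)^T V. By [chase_right], V can
    be corrected to a row cycle; since DG 0 has entries in R_+, which kills the homology of F, z is
    then a boundary. *)
Lemma Fvanish_chase j i (c0 : 'I_(g 0)) : Fvanish_k i j ->
  (forall r m, (1 < r)%N -> (r + m = i.+2)%N -> E1vanish r m j) ->
  Fvanish i.+1 j.
Proof.
move=> vank van z hz cz; have [|W hW iW] := vank z hz.
  by rewrite cz => r c; rewrite mxE; apply: irrelevant0.
(* The rank of K_0 is arbitrary here, so the vector is repeated in every row; row [c0] is read off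
   at the end. *)
pose Z : 'M_(g 0, f i.+1) := \matrix_(r < g 0) (z - W *m DF i.+1).
have rowZ r : row r Z = z - W *m DF i.+1 by rewrite rowK.
have cZ : Z *m DF i = 0.
  apply/row_matrixP => r; rewrite row_mul rowZ mulmxBl cz -mulmxA DFDF mulmx0.
  by rewrite subrr row0.
have [||V hV eV] := @d1_exact0 j _ Z.
- move=> r c; rewrite mxE dg0 subr0.
  exact: (hommxB hz (hommxM hW (@DF_hom _))).
- by move=> r c; rewrite mxE.
have [||V' hV' eV'] := @d1_exact j _ _ (V *m DF i).
- exact: homdc_d2.
- by rewrite mulmxA -eV.
have [||U [U2 [hU hU2 eU]]] := chase_right hV'.
- by rewrite -eV'; apply: Fcycle_boundary.
- by move=> r m r2 e; apply: van; rewrite // e.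
have cV : Fcycle (V - (DG 1)^T *m U2).
  by rewrite /= mulmxBl eV' eU mulmxDr mulmxA DGDGt mul0mx add0r mulmxA subrr.
have eZ : Z = (DG 0)^T *m (V - (DG 1)^T *m U2).
  by rewrite mulmxBr -eV mulmxA DGDGt mul0mx subr0.
have [|T eT] := irr_cycle_boundary (x := row c0 (DG 0)^T) _ cV.
  by move=> r c; rewrite !mxE; apply: DG_min.
exists (T + W); rewrite mulmxDl -eT -row_mul -eZ rowZ.
by rewrite subrK.
Qed.

(** Start from e_c (x) u, where u represents 1 in k. Its column differential has coefficients in
    R_+, hence is a row boundary Y DF. If all targets vanished, [chase_left] would correct e_c (x) u
    by some C DF to a column cycle, that is a column boundary, with entries in R_+ by minimality;
    row c then contradicts the choice of u. *)
Lemma basis_chase p (c : 'I_(g p.+1)) (u : 'rV_(f 0)) :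
  hommx G (fun=> 0) (@df 0) u ->
  (forall w, ~ irrmx G (u - w *m DF 0)) ->
  Fvanish_k p (dg c) ->
  ~ (forall p' m', (p' < p)%N -> (p' + m' = p)%N -> E1vanish p' m' (dg c)).
Proof.
move=> hu nu vank van; pose X : 'M_(g p.+1, f 0) := delta_mx c 0 *m u.
have XE r s : X r s = if r == c then u 0 s else 0.
  rewrite mxE big_ord1 mxE eqxx andbT; case: ifP => _.
    exact: mul1r.
  exact: mul0r.
clearbody X; have hX : homdc (dg c) X.
  move=> r s; rewrite XE; case: eqP => [->|_].
    by have := hu 0 s; rewrite subrr.
  exact: (grading0 (zgrading G)).
have [|Y hY eY] := hom_solve (@DF_hom 0) (homdc_d1 hX).
  move=> r; rewrite row_mul; apply: irr_cycle_boundary => // a b.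
  by rewrite !mxE; apply: DG_min.
have [||p' m' pp' e|C [W [hC hW eC]]] := @chase_left (dg c) p 0 Y hY.
- by rewrite -eY; apply: d2_irr_boundary.
- by rewrite add0n.
- by apply: van => //; rewrite e addn0.
have [||V hV eV] := @d1_exact (dg c) _ _ (X - C *m DF 0).
- by apply: hommxB => //; apply: homdc_d2.
- rewrite mulmxBr eY eC mulmxDl -(mulmxA W) DFDF mulmx0 addr0 mulmxA.
  by rewrite subrr.
apply: (nu (row c C)) => r s; rewrite ord1 {r}.
have := irrmxM V (irrmx_tr (@DG_min p.+1)) c s; rewrite -eV.
by rewrite -row_mul !mxE [X c s]XE eqxx.
Qed.

End DoubleComplex.

(** * Reduction modulo I and change of rings *)

Section QuotientGrading.
Variables (k : fieldType) (A : comAlgType k) (G : std_grading A).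
Variables (I : idealr A) (hI : homogeneous G I).
Local Notation Q := (quot_alg I).
Local Notation pi := (quot_pi I).
Local Notation QG := (quot_grading hI).

Lemma intpart_quotP j (y : Q) :
  intpart QG j y <-> exists2 x, intpart G j x & pi x = y.
Proof.
case: j => j /=; first by [].
by split=> [->|[x -> <-]]; [exists 0; rewrite ?rmorph0|rewrite rmorph0].
Qed.

Lemma zcomp_quot j x : zcomp QG j (pi x) = pi (zcomp G j x).
Proof.
apply: (component_morph _ _ (sigma := id)) => // [|i u Gu].
  exact: rmorphD.
by apply/intpart_quotP; exists u.
Qed.

(* A nonzero element of degree 0 is a unit, hence is not in I. *)
Lemma irrelevant_quot x : (pi x \in irrelevant QG) = (x \in irrelevant G).
Proof.
rewrite !irrelevantE zcomp_quot; apply/eqP/eqP => [|->]; last exact: rmorph0.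
have [a ->] := hpart0P (zcompP G 0 x); move/quot_pi_eq0 => Ia.
have [->|a0] := eqVneq a 0; first by rewrite scale0r.
suff : 1 \in I by rewrite idealr1.
have -> : 1 = a^-1%:A * a%:A :> A.
  by rewrite -scalerAl mul1r scalerA mulVf // scale1r.
exact: idealMr.
Qed.

Lemma hommx_quot m n dr dc (M : 'M[A]_(m, n)) :
  hommx G dr dc M -> hommx QG dr dc (map_mx pi M).
Proof.
by move=> hM r c; rewrite mxE; apply/intpart_quotP; exists (M r c).
Qed.

Lemma hommx_lift m n dr dc (M : 'M[Q]_(m, n)) : hommx QG dr dc M ->
  exists2 M' : 'M[A]_(m, n), hommx G dr dc M' & map_mx pi M' = M.
Proof.
move=> hM; have h r c : {x : A | intpart G (dr r - dc c) x & pi x = M r c}.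
  exact/cid2/intpart_quotP.
exists (\matrix_(r, c) s2val (h r c)) => [r c|].
  by rewrite mxE; apply: (s2valP (h r c)).
by apply/matrixP => r c; rewrite !mxE (s2valP' (h r c)).
Qed.

Lemma irrmx_quot m n (M : 'M[A]_(m, n)) :
  irrmx QG (map_mx pi M) <-> irrmx G M.
Proof.
by split=> hM r c; have := hM r c; rewrite mxE irrelevant_quot.
Qed.

End QuotientGrading.

Section ChangeOfRings.
Variables (k : fieldType) (A : comAlgType k) (G : std_grading A).
Variable F : free_resolution (residue_field G).
Local Notation d := (res_diff F).
Local Notation deg := (@res_deg _ _ _ _ F).

Lemma res_diff_comp m : d m.+1 *m d m = 0.
Proof.
apply/row_matrixP => r; rewrite row_mul row0; apply/res_exactS.
by exists (delta_mx 0 r); rewrite rowE.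
Qed.

Lemma aug_irr (v : 'rV[A]_(res_rank F 0)) :
  irrmx G v -> \sum_c v 0 c *: res_aug c = 0.
Proof. by move=> iv; rewrite big1 // => c _; apply: irrelevant_scale. Qed.

Lemma aug_component (v : 'rV[A]_(res_rank F 0)) :
  component (gm_grading (residue_field G)) 0 (\sum_c v 0 c *: res_aug c) =
  \sum_c rowcomp G (@deg 0) 0 v 0 c *: res_aug c.
Proof.
rewrite component_sum; apply: eq_bigr => c _; rewrite mxE.
rewrite -[X in component _ X](subrK (deg c) 0).
apply: (component_morph (zgrading G) _ (phi := fun a => a *: res_aug c)
  (sigma := fun j => j + deg c)).
- by move=> x y; rewrite scalerDl.
- exact: addIr.
- case=> i x Gx; first by apply: gm_scale => //; apply: res_aug_hom.
  by rewrite Gx scale0r; apply: (grading0 (gm_grading _)).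
Qed.

(** Take u over 1 in k: the augmentation kills boundaries and A_+ F_0, but not u. *)
Lemma unit_lift : exists2 u : 'rV[A]_(res_rank F 0),
  hommx G (fun=> 0) (@deg 0) u & forall w, ~ irrmx G (u - w *m d 0).
Proof.
have [v ev] := res_aug_surj F (res1 G).
exists (rowcomp G (@deg 0) 0 v) => [|w iw]; first exact: rowcomp_hom.
have e1 : component (gm_grading (residue_field G)) 0 (res1 G) = res1 G.
  have h1 : @gm_part _ _ _ (residue_field G) 0 (res1 G).
    by exists 1; [rewrite hpart_0; exists 1; rewrite ?scale1r|].
  by rewrite (component_hom _ _ h1).
apply: (@res1_neq0 _ _ G); rewrite -e1 ev aug_component -[RHS](aug_irr iw).
under [RHS]eq_bigr do rewrite !mxE scalerBl.
rewrite sumrB -[LHS]subr0; congr (_ - _).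
  by apply: eq_bigr => c _; rewrite !mxE.
rewrite -[LHS](proj2 (res_exact0 (w *m d 0)) (ex_intro _ w erefl)).
by apply: eq_bigr => c _; rewrite mxE.
Qed.

Lemma row_solve m n p (X : 'M[A]_(m, p)) (D : 'M[A]_(n, p)) :
  (forall r, exists w, row r X = w *m D) -> exists H, X = H *m D.
Proof.
move=> h; have [w wP] := choice h; exists (\matrix_r w r).
by apply/row_matrixP => r; rewrite row_mul rowK.
Qed.

(* E is the term d_(m-1) H_(m-1) of a homotopy H from x to 0. *)
Lemma null_homotopy m x : x \in irrelevant G ->
  exists (H : 'M_(res_rank F m, res_rank F m.+1)) (E : 'M_(res_rank F m)),
    [/\ x%:M = H *m d m + E, d m *m E = 0 &
        match m return 'M_(res_rank F m) -> Prop with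
        | 0 => fun E => E = 0
        | m'.+1 => fun E => exists H', E = d m' *m H'
        end E].
Proof.
move=> ix; elim: m => [|m [H [E [eH dE _]]]].
  have [r|H eH] := row_solve (X := x%:M) (D := d 0).
    apply/res_exact0/aug_irr => a c; rewrite !mxE.
    by case: eqP => _; [rewrite mulr1n|rewrite mulr0n irrelevant0].
  by exists H, 0; rewrite addr0 mulmx0.
have dH : (x%:M - d m *m H) *m d m = 0.
  rewrite mulmxBl -mulmxA mul_scalar_mx.
  have -> : H *m d m = x%:M - E by rewrite eH addrK.
  by rewrite mulmxBr dE subr0 mul_mx_scalar subrr.
have [r|H' eH'] := row_solve (X := x%:M - d m *m H) (D := d m.+1).
  by apply/res_exactS; rewrite -row_mul dH row0.
exists H', (d m *m H); split; last by exists H.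
  by rewrite -eH' subrK.
by rewrite mulmxA res_diff_comp mul0mx.
Qed.

Variables (I : idealr A) (hI : homogeneous G I).
Local Notation Q := (quot_alg I).
Local Notation pi := (quot_pi I).
Local Notation QG := (quot_grading hI).

Definition quot_diff (J : idealr A) m : 'M[quot_alg J]_(_, _) :=
  map_mx (quot_pi J) (d m).

Lemma quot_diff_hom m : hommx QG (@deg m.+1) (@deg m) (quot_diff I m).
Proof. exact/hommx_quot/res_diff_hom. Qed.

Lemma quot_diff_comp (J : idealr A) m :
  quot_diff J m.+1 *m quot_diff J m = 0.
Proof. by rewrite -map_mxM res_diff_comp map_mx0. Qed.

(** Reduce the homotopy from x to 0 modulo I: on a cycle its term E vanishes, which leaves a
    boundary. *)
Lemma quot_diff_null m (x : Q) (X : 'rV_(res_rank F m)) :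
  x \in irrelevant QG -> Fcycle (quot_diff I) X ->
  exists W, x *: X = W *m quot_diff I m.
Proof.
have [{}x <-] := quot_pi_surj x; rewrite irrelevant_quot => ix cX.
have [H [E [eH _ EP]]] := null_homotopy m ix.
exists (X *m map_mx pi H); rewrite -mulmxA -map_mxM.
have -> : H *m d m = x%:M - E by rewrite eH addrK.
rewrite map_mxB map_scalar_mx mulmxBr mul_mx_scalar.
suff -> : X *m map_mx pi E = 0 by rewrite subr0.
case: m X cX E EP {H eH} => [|m] X cX E /= => [->|[H ->]].
  by rewrite map_mx0 mulmx0.
by rewrite map_mxM mulmxA cX mul0mx.
Qed.

Lemma tens_diff_quot (J : idealr A) (hJ : homogeneous G J) m
    (X : 'rV[quot_alg J]_(res_rank F m.+1)) c :
  @tens_diff _ _ _ _ (quot_module hJ) F m (fun c => X 0 c) c =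
  (X *m quot_diff J m) 0 c.
Proof.
rewrite mxE; apply: eq_bigr => r _.
by rewrite mxE [RHS]mulrC.
Qed.

Lemma Fvanish_quot (J : idealr A) (hJ : homogeneous G J) m j :
  ~ homology_neq0 (quot_module hJ) F m j ->
  Fvanish (quot_grading hJ) deg (quot_diff J) m j.
Proof.
move=> h0 X hX cX; apply: contrapT => nW; apply: h0.
exists (fun c => X 0 c); split=> [c||[w hw ew]]; first exact: hX.
  case: m X {hX nW} cX => [//|m] X cX c; rewrite tens_diff_quot.
  by move: cX => /= ->; rewrite mxE.
pose W : 'rV[quot_alg J]_(res_rank F m.+1) := \row_c w c.
have eW : w = fun c => W 0 c by apply/funext => c; rewrite mxE.
apply: nW; exists W; apply/rowP => c.
by rewrite -(tens_diff_quot hJ) -eW ew.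
Qed.

Lemma Fvanish_homology m j : Fvanish QG deg (quot_diff I) m j ->
  ~ homology_neq0 (quot_module hI) F m j.
Proof.
move=> van [z [hz cz nz]]; pose X : 'rV[Q]_(res_rank F m) := \row_c z c.
have zX : z = fun c => X 0 c by apply/funext => c; rewrite mxE.
have hX : hommx QG (fun=> j) (@deg m) X by move=> r c; rewrite mxE; apply: hz.
have cX : Fcycle (quot_diff I) X.
  case: m z X zX cz {van hz nz hX} => [//|m] z X zX cz; apply/rowP => c.
  by have := cz c; rewrite zX tens_diff_quot => ->; rewrite mxE.
have [|W hW eW] := hom_solve (@quot_diff_hom m) hX.
  by move=> r; rewrite ord1 row_id; apply: van.
apply: nz; exists (fun c => W 0 c) => [c|c]; first exact: hW.
by rewrite tens_diff_quot -eW mxE.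
Qed.

(** A lift to F_0 of a vector of degree j has augmentation in k_j = 0, so it is already a boundary
    over S. *)
Lemma Fvanish0_quot j : 0 < j -> Fvanish QG deg (quot_diff I) 0 j.
Proof.
move=> j0 X /hommx_lift[X' hX' <-] _.
have [|w ->] := proj1 (res_exact0 X'); last first.
  by exists (map_mx pi w); rewrite map_mxM.
rewrite big1 // => c _.
have : @gm_part _ _ _ (residue_field G) j (X' 0 c *: res_aug c).
  have := hX' 0 c; rewrite -[X in gm_part X](subrK (deg c)).
  case: (j - deg c) => i Gi; first by apply: gm_scale => //; apply: res_aug_hom.
  by rewrite Gi scale0r; apply: (grading0 (gm_grading _)).
move=> /(intpart_quotP (irrelevant_homogeneous (G := G)))[x Gx <-].
by apply/quot_pi_eq0; apply: irrelevant_hom Gx _; rewrite gt_eqF.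
Qed.

(** (F (x)_S R) (x)_R k is F (x)_S k: lift the matrices to S, then reduce them modulo S_+. *)
Lemma Fvanish_k_quot m j : ~ homology_neq0 (residue_field G) F m.+1 j ->
  Fvanish_k QG deg (quot_diff I) m j.
Proof.
move=> /Fvanish_quot van X hX iX.
have [X' hX' eX] := hommx_lift hX.
have iX' : irrmx G (X' *m d m).
  by apply/(irrmx_quot hI); rewrite map_mxM eX.
pose K := irrelevant G; pose X0 := map_mx (quot_pi K) X'.
have hX0 : hommx (quot_grading (irrelevant_homogeneous (G := G)))
    (fun=> j) (@deg m.+1) X0 by apply: hommx_quot.
have cX0 : Fcycle (quot_diff K) X0.
  rewrite /= -map_mxM; apply/matrixP => r c; rewrite !mxE.
  by apply/quot_pi_eq0; have := iX' r c; rewrite mxE.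
have hd := @res_diff_hom _ _ _ _ F m.+1.
have [|W0 hW0 eW0] := hom_solve (hommx_quot _ hd) hX0.
  by move=> r; rewrite ord1 row_id; apply: van.
have [W hW eW] := hommx_lift hW0.
exists (map_mx pi W); first exact: hommx_quot.
rewrite -eX -map_mxM -map_mxB; apply/irrmx_quot => r c.
apply/(quot_pi_eq0 K); have := congr1 (fun M : 'M_(_, _) => M r c) eW0.
rewrite -eW -map_mxM !mxE => e0.
by rewrite raddfB /= e0 subrr.
Qed.

End ChangeOfRings.

Lemma unit_lift_quot (k : fieldType) (A : comAlgType k) (G : std_grading A)
    (I : idealr A) (hI : homogeneous G I)
    (F : free_resolution (residue_field G)) :
  exists2 u : 'rV[quot_alg I]_(res_rank F 0),
    hommx (quot_grading hI) (fun=> 0) (@res_deg _ _ _ _ F 0) u &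
    forall w, ~ irrmx (quot_grading hI) (u - w *m quot_diff F I 0).
Proof.
have [u hu nu] := unit_lift F.
exists (map_mx (quot_pi I) u) => [|w]; first exact: hommx_quot.
have [W ->] : exists W, w = map_mx (quot_pi I) W.
  have [W eW] := choice (fun c => quot_pi_surj (w 0 c)).
  by exists (\row_c W c); apply/rowP => c; rewrite !mxE eW.
by rewrite -map_mxM -map_mxB => /irrmx_quot/nu.
Qed.

(** * The two inequalities and the final induction *)

Section Inequalities.
Variables (k : fieldType) (S : comAlgType k) (SG : std_grading S).
Variables (I : idealr S) (homI : homogeneous SG I).
Local Notation RG := (quot_grading homI).
Variable F : free_resolution (residue_field SG).
Variable K : free_resolution (residue_field RG).
Local Notation degF := (@res_deg _ _ _ _ F).
Local Notation degK := (@res_deg _ _ _ _ K).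
Local Notation D := (quot_diff F I).
Local Notation vanish := (Fvanish RG degF D).
Local Notation vanish_k := (Fvanish_k RG degF D).
Hypothesis K_min : forall i, irrmx RG (res_diff K i).
Hypothesis K_deg0 : forall c : 'I_(res_rank K 0), res_deg c = 0.
Hypothesis K_rank0 : (0 < res_rank K 0)%N.
Hypothesis K_span0 : forall v : 'rV_(res_rank K 0),
  (exists w, v = w *m res_diff K 0) <-> irrmx RG v.

(* t_i^S(R) <= max (i, t_r^R(k) + t_(i+1-r)^S(R) for 2 <= r <= i + 1) *)
Lemma tor_quot_bound i (j : int) : vanish_k i j ->
  (forall r m (c : 'I_(res_rank K r)), (1 < r)%N -> (r + m = i.+2)%N ->
    vanish m (j - res_deg c)) -> vanish i.+1 j.
Proof.
move=> vank van.
apply: (Fvanish_chase (DG := res_diff K) (dg := degK)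
  (@res_diff_hom _ _ _ _ K) (quot_diff_hom (F := F) homI)
  (@res_diff_comp _ _ _ K) (@quot_diff_comp _ _ _ F I) _ _ K_min K_deg0 _
  (Ordinal K_rank0) vank).
- by move=> p v /res_exactS.
- by move=> v /K_span0.
- by move=> m x X; apply: quot_diff_null.
- by move=> r m r1 e c; apply: van.
Qed.

(* t_p^R(k) <= max (p, t_(p-r)^R(k) + t_(r-1)^S(R) for 2 <= r <= p) *)
Lemma res_deg_bound p (c : 'I_(res_rank K p.+1)) : vanish_k p (res_deg c) ->
  ~ (forall p' m (c' : 'I_(res_rank K p')), (p' < p)%N -> (p' + m = p)%N ->
      vanish m (res_deg c - res_deg c')).
Proof.
move=> vank van; have [u hu nu] := unit_lift_quot homI F.
apply: (basis_chase (DG := res_diff K) (dg := degK)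
  (@res_diff_hom _ _ _ _ K) (quot_diff_hom (F := F) homI)
  (@res_diff_comp _ _ _ K) (@quot_diff_comp _ _ _ F I) _ _ K_min K_deg0 _
  hu nu vank).
- by move=> q v /res_exactS.
- by move=> v /K_span0.
- by move=> m x X; apply: quot_diff_null.
- by move=> p' m lt_p' e c'; apply: van.
Qed.

End Inequalities.

Theorem corollary2p7 (k : fieldType) (S : comAlgType k) (SG : std_grading S)
    (noethS : noetherian S) (koszulS : koszul SG)
    (I : idealr S) (homI : homogeneous SG I)
    (no_linear : forall x : S, hpart SG 1 x -> x \in I -> x = 0)
    (n q : nat) (n_ge1 : (1 <= n)%N) (q_ge1 : (1 <= q)%N)
    (regR : (reg_upto (residue_field (quot_grading homI)) n.+1 <= 1%:E)%E)
    (NqR : green_lazarsfeld homI q) (i : nat) (i_range : (q.+1 <= i <= n)%N) :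
  (tdeg (quot_module homI) i <= (2 * i%:Z - q%:Z + 1)%:E)%E.
Proof.
(* The resolution F carrying the offending class is used throughout: [Tor_neq0] ranges over all
   resolutions, so the bounds on [tdeg] apply to F itself. *)
apply: tdeg_le => j [F hF]; rewrite leNgt; apply/negP => lt_j.
have [K [K_min K_deg0 K_rank0 K_span0]] :=
  minimal_resolution (quot_grading homI) (noetherian_quot (I := I) noethS).
pose vanish := Fvanish (quot_grading homI) (@res_deg _ _ _ _ F) (quot_diff F I).
have vank m l : m.+1%:Z < l ->
    Fvanish_k (quot_grading homI) (@res_deg _ _ _ _ F) (quot_diff F I) m l.
  move=> lt_l; apply: Fvanish_k_quot => hl; move: lt_l; apply/negP.
  rewrite -leNgt; apply: (@Tor_neq0_le _ _ _ (residue_field SG) m.+1).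
    rewrite -[X in (X%:E)%E]addr0; apply: (tdeg_reg_upto (leqnn _)).
    by rewrite -[X in (_ <= X)%E]koszulS; apply: reg_upto_reg.
  by exists F.
(* The term [(0 < m)] merges s_0 <= 0 with s_m <= m + 1 for 1 <= m <= q. *)
have van_gl m l : (m <= q)%N -> (m + (0 < m))%N%:Z < l -> vanish m l.
  case: m => [|m] le_mq lt_l; first exact: Fvanish0_quot.
  apply: Fvanish_quot => hl; move: lt_l; apply/negP; rewrite -leNgt addn1.
  apply: (@Tor_neq0_le _ _ _ (quot_module homI) m.+1); last by exists F.
  by rewrite NqR.
(* For p' + m = p with 1 <= m <= q, t_p' + s_m <= p' + (m + 1) = p + 1, so t_(p+1) <= p + 1. *)
have degK p (c : 'I_(res_rank K p)) : (p <= q.+1)%N -> res_deg c <= p%:Z.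
  elim/ltn_ind: p c => -[|p] IHp c le_pq; first by rewrite K_deg0.
  rewrite leNgt; apply/negP => lt_c.
  apply: (res_deg_bound K_min K_deg0 K_span0 (vank _ _ lt_c)).
  move=> p' m c' lt_p' e; apply: van_gl; first by lia.
  have dc' : res_deg c' <= p'%:Z by apply: IHp; lia.
  by case: m e => [|m] /= e; lia.
have degK1 p (c : 'I_(res_rank K p)) : (p <= n.+1)%N -> res_deg c <= p%:Z + 1.
  move=> le_pn; apply: (Tor_neq0_le (tdeg_reg_upto le_pn regR)).
  exact: minimal_Tor_neq0.
suff van m l : (q < m <= n)%N -> 2 * m%:Z - q%:Z + 1 < l -> vanish m l.
  exact: (Fvanish_homology (van _ _ i_range lt_j) hF).
elim/ltn_ind: m l => -[//|m] IHm l /andP[lt_qm le_mn] lt_l.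
apply: (tor_quot_bound K_min K_deg0 K_rank0 K_span0).
  by apply: vank; lia.
move=> r m' c r1 e; 
have dc : res_deg c <= if (r <= q.+1)%N then r%:Z else r%:Z + 1.
  by case: ifP => [/degK|_]; [apply|apply: degK1; lia].
(* Here r + m' = m + 2 and the target is 2(m + 1) - q + 1. If m' <= q, the sum is at most m + 3 <=
   2m + 3 - q, except when r > q + 1 and m' > 0: then it is at most m + 4, but m + 2 >= q + 3. If m'
   > q, the induction hypothesis reduces the claim to t_r <= 2r - 2: this holds for t_r <= r as r >=
   2, and for t_r <= r + 1 as then r >= q + 2 >= 3. *)
case: (leqP m' q) => [le_m'|lt_m'].
  apply: van_gl => //.
  by case: m' e le_m' => [|m'] /= e le_m'; move: dc; case: ifP; lia.
by apply: IHm; move: dc; case: ifP; lia.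
Qed.
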